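(* Let $\mathbf{K}$ be a field and let $V$ be a vector space over $\mathbf{K}$ with finite positive dimension. Let $(A,A^* )$ be a Leonard pair on $V$. Then there exists a sequence of scalars $\beta,\gamma,\gamma^*,\varrho,\varrho^*,\omega,\eta,\eta^*$ taken from $\mathbf{K}$ such that both $$A^2A^*-\beta AA^*A+A^*A^2-\gamma(AA^*+A^*A)-\varrho A^*=\gamma^*A^2+\omega A+\eta I,$$ $$A^{*2}A-\beta A^*AA^*+AA^{*2}-\gamma^*(A^*A+AA^* )-\varrho^*A=\gamma A^{*2}+\omega A^*+\eta^*I.$$ Moreover, the sequence is uniquely determined by the pair $(A,A^* )$ provided the dimension of $V$ is at least $4$.
   Context: A square matrix is tridiagonal if each nonzero entry lies on the diagonal, the subdiagonal, or the superdiagonal; a tridiagonal matrix is irreducible if every entry on the subdiagonal is nonzero and every entry on the superdiagonal is nonzero. Let $V$ be a vector space over $\mathbf{K}$ with finite positive dimension. A Leonard pair on $V$ is an ordered pair $(A,A^* )$ of linear transformations $A:V\to V$, $A^*:V\to V$ such that: (i) there exists a basis of $V$ with respect to which the matrix representing $A$ is irreducible tridiagonal and the matrix representing $A^*$ is diagonal; (ii) there exists a basis of $V$ with respect to which the matrix representing $A^*$ is irreducible tridiagonal and the matrix representing $A$ is diagonal. ($A^*$ does not denote an adjoint or conjugate transpose; it is just a second linear transformation.) $I$ denotes the identity on $V$. *)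

(* Defs.v *)
From mathcomp Require Import all_boot all_order all_algebra.

Set Implicit Arguments.
Unset Strict Implicit.
Unset Printing Implicit Defensive.

Import GRing.Theory.
Local Open Scope ring_scope.
Local Open Scope lfun_scope.

Definition tridiagonal (K : fieldType) (n : nat) (M : 'M[K]_n) : Prop :=
  forall i j : 'I_n,
    M i j != 0 -> [|| i == j, i == j.+1 :> nat | j == i.+1 :> nat].

Definition irreducible_tridiagonal (K : fieldType) (n : nat) (M : 'M[K]_n) :
    Prop :=
  [/\ tridiagonal M,
      forall i j : 'I_n, i = j.+1 :> nat -> M i j != 0
    & forall i j : 'I_n, j = i.+1 :> nat -> M i j != 0].

(* [passmx.mxof] acts on row vectors; the transpose makes column [j] hold the
   coordinates of [f b`_j]. *)
Definition matrix_in_basis (K : fieldType) (V : vectType K)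
    (b : (\dim {:V}).-tuple V) (f : 'End(V)) : 'M[K]_(\dim {:V}) :=
  (passmx.mxof b b f)^T.

Definition Leonard_pair (K : fieldType) (V : vectType K) (A As : 'End(V)) :
    Prop :=
  (exists b : (\dim {:V}).-tuple V,
    [/\ basis_of {:V} b,
        irreducible_tridiagonal (matrix_in_basis b A)
      & is_diag_mx (matrix_in_basis b As)]) /\
  (exists b : (\dim {:V}).-tuple V,
    [/\ basis_of {:V} b,
        irreducible_tridiagonal (matrix_in_basis b As)
      & is_diag_mx (matrix_in_basis b A)]).

(* [\o] and [+] have the same precedence level, hence the parentheses. *)
Definition Askey_Wilson (K : fieldType) (V : vectType K) (A As : 'End(V))
    (beta gamma gammas rho rhos omega eta etas : K) : Prop :=
  (A \o A \o As) - beta *: (A \o As \o A) + (As \o A \o A)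
    - gamma *: ((A \o As) + (As \o A)) - rho *: As
  = gammas *: (A \o A) + omega *: A + eta *: \1
  /\
  (As \o As \o A) - beta *: (As \o A \o As) + (A \o As \o As)
    - gammas *: ((As \o A) + (A \o As)) - rhos *: A
  = gamma *: (As \o As) + omega *: As + etas *: \1.

(* Main.v *)
From HB Require Import structures.
Require Import Defs.
From mathcomp Require Import all_boot all_order all_algebra.
From mathcomp Require Import ring.

Set Implicit Arguments.
Unset Strict Implicit.
Unset Printing Implicit Defensive.

Import GRing.Theory.
Local Open Scope ring_scope.

(** In a basis of the first kind A is irreducible tridiagonal and As is
diagonal, with entries t*_0, ..., t*_d; in a basis of the second kind A is
diagonal, with entries t_0, ..., t_d, and As is irreducible tridiagonal.
Everything comes from moving identities between the two bases.  Two facts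
carry the argument.

- A matrix commuting with an irreducible tridiagonal M is determined by its
  first row, because M spreads row i to row i + 1; since the first row of M^k
  ends exactly at column k, a matrix in the commutant of M whose first row
  vanishes from column m on is a polynomial of degree less than m in M
  ([centralizer_poly]).  As a first consequence the t_i are distinct, and
  dually so are the t*_i ([eigenvalue_inj]).

- In the second basis the left side of the first relation has (i, j) entry
  f(t_i, t_j) times that of As, where
    f(x, y) = x^2 - beta x y + y^2 - gamma (x + y) - rho
  ([aw_word_diag]).  So it commutes with A as soon as f(t_i, t_{i+1}) = 0 for
  all i.

Suitable beta, gamma, rho are found as follows.  The commutator of As with a
matrix that is diagonal in the second basis can be prescribed on the two
off-diagonals, so A^2 As A - A As A^2 = X As - As X for some X commuting with A.
In the first basis the left side has bandwidth 3, so the first row of X ends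
at column 3 and X = c0 + c1 A + c2 A^2 + c3 A^3.  The entry (0, 3) gives
c3 (t*_3 - t*_0) = t*_2 - t*_1, so c3 is nonzero, and the entries (i, i + 1) in
the second basis become f(t_i, t_{i+1}) = 0 with beta + 1 = 1 / c3.  Exchanging
A and As gives dual scalars.  The two values of beta agree: subtracting
consecutive relations f(t_i, t_{i+1}) = 0 twice gives
t_3 - t_0 = (beta + 1) (t_2 - t_1), whereas the dual construction yields this
same relation for the dual beta ([aw_form_scalars]).  In dimension at most 3
there are so few relations that beta = 0 works.

With these scalars, the left side of the first relation minus gamma* A^2
commutes with A and, in the first basis, its first row is supported on columns
0 and 1: the (0, 2) entry is a multiple of t*_0 - beta t*_1 + t*_2 - gamma*,
which is 0.  So it equals omega A + eta ([aw_word_linear]).  Dually for the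
second relation, with a coefficient omega'.  Comparing two commutators
([aw_word_commutators]) gives omega [A, As] = omega' [A, As], and [A, As] is
nonzero in dimension at least 2, so omega = omega'.

For uniqueness, the first relation read in the second basis forces
f(t_i, t_{i+1}) = 0, and three consecutive such equations with distinct t_i
determine beta, gamma and rho ([aw_form_inj]); then omega and eta are
determined since A is not scalar. *)

(** * Commutant of an irreducible tridiagonal matrix *)

Section Band.

Variables (K : fieldType) (d : nat).
Implicit Types M N : 'M[K]_d.+1.

(** One-sided: only the entries above the k-th superdiagonal must vanish, which
is all that the first row sees. *)
Definition band (k : nat) M := forall i j : 'I_d.+1, (i + k < j)%N -> M i j = 0.

Lemma band_mul k l M N : band k M -> band l N -> band (k + l) (M * N).
Proof.
move=> bM bN i j ij; rewrite mxE big1 // => m _.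
case: (ltnP (i + k) m) => im; first by rewrite bM ?mul0r.
by rewrite bN ?mulr0 //; apply: leq_ltn_trans ij; rewrite addnA leq_add2r.
Qed.

(** On the outermost superdiagonal of a product only one term of the sum
survives. *)
Lemma band_mul_edge k l M N (i m j : 'I_d.+1) :
  band k M -> band l N -> m = (i + k)%N :> nat -> j = (m + l)%N :> nat ->
  (M * N) i j = M i m * N m j.
Proof.
move=> bM bN im mj; rewrite mxE (bigD1 m) //= big1 ?addr0 // => h hm.
case: (ltnP (i + k) h) => ih; first by rewrite bM ?mul0r.
rewrite bN ?mulr0 // mj ltn_add2r im ltn_neqAle ih andbT.
by apply: contra hm => /eqP hE; apply/eqP/val_inj; rewrite /= hE im.
Qed.

Lemma diag_band M : is_diag_mx M -> band 0 M.
Proof.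
move=> /is_diag_mxP dM i j; rewrite addn0 => ij; apply: dM.
by apply: contraTneq ij => ->; rewrite ltnn.
Qed.

Lemma tridiagonal_band M : irreducible_tridiagonal M -> band 1 M.
Proof.
case=> tM _ _ i j; rewrite addn1 => ij; apply: contraTeq ij => /tM.
case/or3P => [/eqP->|/eqP->|/eqP->]; rewrite ?ltnn //.
  by rewrite -leqNgt leqW.
by rewrite -leqNgt leqW.
Qed.

Lemma diag_mull M N i j : is_diag_mx M -> (M * N) i j = M i i * N i j.
Proof.
move=> /is_diag_mxP dM; rewrite mxE (bigD1 i) //= big1 ?addr0 // => h hi.
by rewrite dM ?mul0r // eq_sym.
Qed.

Lemma diag_mulr M N i j : is_diag_mx M -> (N * M) i j = N i j * M j j.
Proof.
move=> /is_diag_mxP dM; rewrite mxE (bigD1 j) //= big1 ?addr0 // => h hj.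
by rewrite dM ?mulr0.
Qed.

Lemma band_exp M : irreducible_tridiagonal M ->
  forall k, band k (M ^+ k) /\
    forall i j : 'I_d.+1, j = (i + k)%N :> nat -> (M ^+ k) i j != 0.
Proof.
move=> iM; have bM := tridiagonal_band iM; have [_ _ uM] := iM.
elim=> [|k [bk nk]].
  split=> [|i j].
    by rewrite expr0; apply: diag_band; apply: scalar_mx_is_diag.
  by rewrite addn0 => ij; rewrite expr0 mxE (ord_inj ij) eqxx oner_neq0.
split=> [|i j ij]; rewrite exprS; first by rewrite -add1n; apply: band_mul.
have lt : (i.+1 < d.+1)%N.
  by apply: leq_ltn_trans (ltn_ord j); rewrite ij addnS ltnS leq_addr.
rewrite (@band_mul_edge 1 k _ _ i (Ordinal lt)) ?addn1 //=; last first.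
  by rewrite ij addnS.
by rewrite mulf_neq0 ?uM ?nk //= ij addnS.
Qed.

(** Row m of the equation N M = M N expresses M m (m+1) times row m + 1 of N
through the rows of N of index at most m. *)
Lemma centralizer_row0 M N : irreducible_tridiagonal M -> N * M = M * N ->
  (forall j, N 0 j = 0) -> N = 0.
Proof.
move=> iM cNM N0; have [_ _ uM] := iM; have bM := tridiagonal_band iM.
suff N_le m : forall i : 'I_d.+1, (i <= m)%N -> forall j, N i j = 0.
  by apply/matrixP => i j; rewrite mxE (N_le i).
elim: m => [|m IH] i.
  by rewrite leqn0 => /eqP i0 j; rewrite (_ : i = 0) //; apply: val_inj.
rewrite leq_eqVlt => /predU1P[im j|]; last by rewrite ltnS; apply: IH.
have lt : (m < d.+1)%N by apply: ltn_trans (ltn_ord i); rewrite im.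
have := congr1 (fun X : 'M_d.+1 => X (Ordinal lt) j) cNM.
rewrite !mxE big1; last by move=> h _; rewrite IH ?mul0r.
rewrite (bigD1 i) //= big1; last first.
  move=> h hi; case: (ltnP m.+1 h) => mh; first by rewrite bM ?mul0r //= addn1.
  rewrite IH ?mulr0 // -ltnS ltn_neqAle mh andbT.
  by apply: contra hi => /eqP hE; apply/eqP/val_inj; rewrite /= hE.
move/esym/eqP; rewrite addr0 mulf_eq0 => /orP[|/eqP //].
by move/negPn/negP; case; apply: uM.
Qed.

(** The first rows of 1, M, ..., M^(m-1) are triangular with nonzero diagonal,
so subtracting multiples of the powers of M, the highest first, reduces the
first row of N to 0. *)
Lemma centralizer_poly M N m : irreducible_tridiagonal M -> N * M = M * N ->
  (forall j : 'I_d.+1, (m <= j)%N -> N 0 j = 0) ->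
  exists2 p : {poly K}, (size p <= m)%N & N = horner_mx M p.
Proof.
move=> iM; elim: m N => [|m IH] N cN N0.
  exists 0; rewrite ?size_poly0 // rmorph0.
  apply: centralizer_row0 cN _ => // j.
  exact: N0.
case: (ltnP m d.+1) => lt; last first.
  have [j mj|p sp ->] := IH N cN; last by exists p; rewrite ?leqW.
  by move: (ltn_ord j); rewrite ltnNge (leq_trans lt mj).
have [bMm nMm] := band_exp iM m; pose k := Ordinal lt.
pose c := N 0 k / (M ^+ m) 0 k.
have [||p sp] := IH (N - c *: M ^+ m).
- by rewrite mulrBl mulrBr cN -scalerAl -scalerAr -exprSr exprS.
- move=> j; rewrite leq_eqVlt => /predU1P[mj|mj].
    rewrite (_ : j = k); last exact: val_inj.
    by rewrite !mxE /c divfK ?subrr // nMm.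
  by rewrite !mxE N0 // bMm ?mulr0 ?subr0.
move/(canRL (subrK _)) => ->; exists (p + c *: 'X^m).
  rewrite (leq_trans (size_polyD _ _)) // geq_max (leqW sp) /=.
  by rewrite (leq_trans (size_scale_leq _ _)) // size_polyXn.
by rewrite rmorphD /= horner_mxZ rmorphXn /= horner_mx_X.
Qed.

Lemma centralizer_comm M X Y : irreducible_tridiagonal M ->
  X * M = M * X -> Y * M = M * Y -> X * Y = Y * X.
Proof.
move=> iM cX cY.
have [j|p _ ->] := @centralizer_poly M X d.+1 iM cX; last first.
  by apply/esym; apply: comm_mx_horner.
by move/leq_trans/(_ (leq_ord j)); rewrite ltnn.
Qed.

End Band.

Section Entries.
Variables (K : fieldType) (d : nat) (M N : 'M[K]_d.+1) (i j : 'I_d.+1).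

Lemma entryD : (M + N) i j = M i j + N i j. Proof. by rewrite mxE. Qed.
Lemma entryN : (- M) i j = - M i j. Proof. by rewrite mxE. Qed.
Lemma entryZ c : (c *: M) i j = c * M i j. Proof. by rewrite mxE. Qed.

End Entries.

Lemma scalar_mx_entry (K : fieldType) d c (i : 'I_d.+1) :
  (c%:M : 'M[K]_d.+1) i i = c.
Proof. by rewrite mxE eqxx. Qed.

(** Unlike [mxE], these rules leave the entries of products folded. *)
Definition entryE := (entryD, entryN, entryZ).

Lemma horner_mx_wide (K : fieldType) d (M : 'M[K]_d.+1) n (p : {poly K}) :
  (size p <= n)%N -> horner_mx M p = \sum_(i < n) p`_i *: M ^+ i.
Proof.
move=> sp; rewrite -[LHS]/((map_poly scalar_mx p).[M]) (@horner_coef_wide _ n).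
  by apply: eq_bigr => i _; rewrite coef_map /= -[RHS]mul_scalar_mx.
by rewrite (leq_trans (size_poly _ _)).
Qed.

(** * Conjugation *)

Section Conj.
Variables (K : fieldType) (d : nat).
Implicit Types P M N : 'M[K]_d.+1.

Definition cnj P M := P * M * P^-1.

Lemma cnjD P M N : cnj P (M + N) = cnj P M + cnj P N.
Proof. by rewrite /cnj mulrDr mulrDl. Qed.
Lemma cnjB P M N : cnj P (M - N) = cnj P M - cnj P N.
Proof. by rewrite /cnj mulrBr mulrBl. Qed.
Lemma cnjZ P c M : cnj P (c *: M) = c *: cnj P M.
Proof. by rewrite /cnj -scalerAr -scalerAl. Qed.
Lemma cnjM P M N : P \is a GRing.unit -> cnj P (M * N) = cnj P M * cnj P N.
Proof. by move=> uP; rewrite /cnj !mulrA mulrVK. Qed.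
Lemma cnjC P c : P \is a GRing.unit -> cnj P c%:M = c%:M.
Proof. by move=> uP; rewrite -scalemx1 cnjZ /cnj mulr1 divrr. Qed.
Lemma cnjK P : P \is a GRing.unit -> cancel (cnj P) (cnj P^-1).
Proof. by move=> uP M; rewrite /cnj invrK !mulrA mulVr // mul1r mulrVK. Qed.
Lemma cnjVK P : P \is a GRing.unit -> cancel (cnj P^-1) (cnj P).
Proof. by move=> uP M; rewrite -{1}(invrK P) cnjK ?unitrV. Qed.
Lemma cnj_quadratic P M c2 c1 c0 : P \is a GRing.unit ->
  cnj P (c2 *: (M * M) + c1 *: M + c0%:M)
  = c2 *: (cnj P M * cnj P M) + c1 *: cnj P M + c0%:M.
Proof. by move=> uP; rewrite !cnjD !cnjZ cnjM // cnjC. Qed.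

End Conj.

(** * The three-term recurrence for the eigenvalues *)

Section Numbers.
Variable (K : fieldType).

Definition aw_form (beta gamma rho x y : K) : K :=
  x ^+ 2 - beta * x * y + y ^+ 2 - gamma * (x + y) - rho.

(** aw_form is symmetric in x and y, so the difference of the two equations is
divisible by x - z. *)
Lemma three_term (b g r x y z : K) : x != z ->
  aw_form b g r x y = 0 -> aw_form b g r y z = 0 -> x - b * y + z = g.
Proof.
rewrite /aw_form -subr_eq0 => xz h1 h2; apply/eqP; rewrite -subr_eq0.
rewrite -(mulrI_eq0 _ (mulfI xz)); apply/eqP.
rewrite -[RHS](subrr 0) -{1}h1 -{1}h2; ring.
Qed.

Lemma four_term (b g r x y z t : K) : x != z -> y != t ->
  aw_form b g r x y = 0 -> aw_form b g r y z = 0 -> aw_form b g r z t = 0 ->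
  t - x = (b + 1) * (z - y).
Proof.
move=> xz yt h1 h2 h3; have e1 := three_term xz h1 h2.
have e2 := three_term yt h2 h3; apply/eqP; rewrite -subr_eq0; apply/eqP.
by rewrite -[RHS](subrr g) -{1}e2 -{1}e1; ring.
Qed.

Lemma aw_form_inj (b g r b' g' r' x y z t : K) : uniq [:: x; y; z; t] ->
  aw_form b g r x y = 0 -> aw_form b g r y z = 0 -> aw_form b g r z t = 0 ->
  aw_form b' g' r' x y = 0 -> aw_form b' g' r' y z = 0 ->
  aw_form b' g' r' z t = 0 -> [/\ b = b', g = g' & r = r'].
Proof.
rewrite /= !inE !negb_or => /and4P[/and3P[xy xz xt] /andP[yz yt] zt _].
move=> h1 h2 h3 k1 k2 k3.
have eb : b = b'.
  apply: (addIr 1); apply: (mulIf (x := z - y)).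
    by rewrite subr_eq0 eq_sym.
  by rewrite -(four_term xz yt h1 h2 h3) -(four_term xz yt k1 k2 k3).
have eg : g = g' by rewrite -(three_term xz h1 h2) -(three_term xz k1 k2) eb.
split=> //; move: h1 k1; rewrite /aw_form eb eg => h1 k1.
by apply/eqP; rewrite -subr_eq0 -[_ - _]opprB oppr_eq0 -(subrr 0) -{1}h1 -{1}k1;
  apply/eqP; ring.
Qed.

End Numbers.

(** * Leonard pairs of matrices *)

Section Leonard.

Variables (K : fieldType) (d : nat).
Implicit Types A S P M N X : 'M[K]_d.+1.

(** P is the change of basis; [leonard_dual] shows that this encoding keeps the
symmetry between the two matrices. *)
Definition leonard_mx A S P :=
  [/\ P \is a GRing.unit,
      irreducible_tridiagonal A, is_diag_mx S,
      is_diag_mx (cnj P A) & irreducible_tridiagonal (cnj P S)].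

Lemma leonard_dual A S P :
  leonard_mx A S P -> leonard_mx (cnj P S) (cnj P A) P^-1.
Proof. by case=> uP iA dS dA iS; split; rewrite ?unitrV ?cnjK. Qed.

(** The commutant of A is commutative.  If two eigenvalues i and j coincided,
the matrix units (i, i) and (i, j) of the eigenbasis would commute with A, but
they do not commute with each other. *)
Lemma eigenvalue_inj A P : P \is a GRing.unit -> irreducible_tridiagonal A ->
  is_diag_mx (cnj P A) -> injective (fun i => cnj P A i i).
Proof.
move=> uP iA dA i j /= ij; apply/eqP/negPn/negP => nij.
have cE (k l : 'I_d.+1) : cnj P A k k = cnj P A l l ->
    cnj P^-1 (delta_mx k l) * A = A * cnj P^-1 (delta_mx k l).
  move=> kl; rewrite -{1 2}(cnjK uP A) -!cnjM ?unitrV //; congr cnj.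
  apply/matrixP => a b.
  rewrite (diag_mull _ _ _ dA) (diag_mulr _ _ _ dA) mxE mulrC.
  by case: eqP => [->|_]; case: eqP => [->|_]; rewrite ?mulr0 ?kl.
have := centralizer_comm iA (cE i i erefl) (cE i j ij).
rewrite -!cnjM ?unitrV // => /(can_inj (cnjVK uP)).
move=> /matrixP/(_ i j)/eqP.
rewrite /GRing.mul /= mul_delta_mx mul_delta_mx_0; last by rewrite eq_sym.
by rewrite !mxE !eqxx oner_eq0.
Qed.

Lemma leonard_injl A S P : leonard_mx A S P ->
  injective (fun i => cnj P A i i).
Proof. by case=> uP iA _ dA _; apply: eigenvalue_inj. Qed.

Lemma leonard_injr A S P : leonard_mx A S P -> injective (fun i => S i i).
Proof.
move=> lA; have := leonard_injl (leonard_dual lA).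
by rewrite cnjK //; case: lA.
Qed.

Lemma inord_le3 k : (3 <= d)%N -> (k <= 3)%N -> (inord k : 'I_d.+1) = k :> nat.
Proof. by move=> d3 k3; rewrite inordK // ltnS (leq_trans k3). Qed.

(** * The left side of the Askey-Wilson relations *)

(** The other relation has left side aw_word N M with the dual scalars. *)
Definition aw_word M N (beta gamma rho : K) :=
  M * M * N - beta *: (M * N * M) + N * M * M - gamma *: (M * N + N * M)
    - rho *: N.

Lemma cnj_aw_word P M N b g r : P \is a GRing.unit ->
  cnj P (aw_word M N b g r) = aw_word (cnj P M) (cnj P N) b g r.
Proof. by move=> uP; rewrite /aw_word !(cnjB, cnjD, cnjZ, cnjM). Qed.

Lemma aw_word_diag M N b g r i j : is_diag_mx M ->
  aw_word M N b g r i j = aw_form b g r (M i i) (M j j) * N i j.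
Proof.
move=> dM; rewrite /aw_word /aw_form.
have -> : M * M * N = M * (M * N) by rewrite mulrA.
rewrite !entryE !(diag_mulr _ _ _ dM) !(diag_mull _ _ _ dM); ring.
Qed.

Definition adjacent_aw M b g r :=
  forall i j : 'I_d.+1, j = i.+1 :> nat -> aw_form b g r (M i i) (M j j) = 0.

(** Its (i, j) entry is zero unless i and j are equal or adjacent, where either
the eigenvalues agree or the form vanishes. *)
Lemma aw_word_diag_comm M N b g r :
  is_diag_mx M -> irreducible_tridiagonal N -> adjacent_aw M b g r ->
  aw_word M N b g r * M = M * aw_word M N b g r.
Proof.
move=> dM [tN _ _] aM; apply/matrixP => i j.
rewrite (diag_mull _ _ _ dM) (diag_mulr _ _ _ dM) aw_word_diag //.
have aC x y : aw_form b g r x y = aw_form b g r y x by rewrite /aw_form; ring.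
have [->|/tN] := eqVneq (N i j) 0; first by rewrite !mulr0 mul0r.
case/or3P => [/eqP->|/eqP ij|/eqP ij]; first exact: mulrC.
  by rewrite aC aM // !mul0r mulr0.
by rewrite aM // !mul0r mulr0.
Qed.

(** The left side minus gs A^2 commutes with A, and the first row of this
difference vanishes from column 2 on. *)
Lemma aw_word_linear A S P b g r gs rs :
  leonard_mx A S P -> adjacent_aw (cnj P A) b g r -> adjacent_aw S b gs rs ->
  exists om et, aw_word A S b g r = gs *: (A * A) + om *: A + et%:M.
Proof.
move=> lA aA aS; have [uP iA dS dA iS] := lA.
have bA := tridiagonal_band iA; have bS := diag_band dS.
pose L := aw_word A S b g r - gs *: (A * A).
have cL : L * A = A * L.
  rewrite /L mulrBl mulrBr -scalerAl -scalerAr mulrA; congr (_ - _).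
  apply: (can_inj (cnjK uP)); rewrite !cnjM // cnj_aw_word //.
  exact: aw_word_diag_comm.
have L0 (j : 'I_d.+1) : (2 <= j)%N -> L 0 j = 0.
  move=> j2; have lt1 : (1 < d.+1)%N.
    by apply: leq_ltn_trans (ltn_ord j); apply: ltnW.
  have bAA := band_mul bA bA.
  have e1 M k : band k M -> (k < 2)%N -> M 0 j = 0.
    by move=> bM k2; apply: bM; rewrite add0n (leq_trans k2).
  have z1 := e1 _ _ (band_mul bA bS) isT.
  have z2 := e1 _ _ (band_mul bS bA) isT.
  have z3 := e1 _ _ bS isT.
  rewrite /L /aw_word !entryE z1 z2 z3 -(mulrA S A A) -(mulrA A S A).
  rewrite (diag_mulr _ _ _ dS) (diag_mull _ _ _ dS).
  move: j2; rewrite leq_eqVlt => /predU1P[j2|j3]; last first.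
    rewrite (bAA 0 j) ?add0n // (band_mul bA (band_mul bS bA)) ?add0n //.
    ring.
  (* The (0, 2) entry vanishes by the three-term recurrence for S. *)
  pose o1 := Ordinal lt1.
  rewrite (band_mul_edge (m := o1) bA bA) //.
  rewrite (band_mul_edge (m := o1) bA (band_mul bS bA)) // (diag_mull _ _ _ dS).
  have n0j : S 0 0 != S j j.
    by apply/eqP => /(leonard_injr lA) j0; move: j2; rewrite -j0.
  have <- := three_term n0j (aS 0 o1 erefl) (aS o1 j (esym j2)).
  ring.
have [p sp Lp] := centralizer_poly iA cL L0.
exists p`_1, p`_0; move/(canRL (subrK _)): Lp => ->.
rewrite (horner_mx_wide _ sp) !big_ord_recl big_ord0 /= addr0 expr0 expr1.
by rewrite scalemx1 addrC [in RHS]addrAC -addrA addrA.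
Qed.

(** * Existence of the scalars *)

(** For X diagonal with entries x_i, the (i, j) entry of X N - N X is
(x_i - x_j) N_ij, so any antisymmetric prescription on adjacent indices is
solved by summing it along the diagonal. *)
Lemma tridiagonal_bracket M N : is_diag_mx M -> irreducible_tridiagonal N ->
  exists2 X, is_diag_mx X &
    X * N - N * X = M * (M * N * M) - M * N * M * M.
Proof.
move=> dM [tN _ _]; pose t k := M (inord k) (inord k).
pose x (i : 'I_d.+1) := \sum_(k < i) t k.+1 * t k * (t k.+1 - t k).
have dX : is_diag_mx (diag_mx (\row_i x i)) by apply: diag_mx_is_diag.
exists (diag_mx (\row_i x i)) => //.
apply/matrixP => i j; rewrite !entryE.
rewrite !(diag_mull _ _ _ dX) !(diag_mulr _ _ _ dX) !(diag_mull _ _ _ dM)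
  !(diag_mulr _ _ _ dM) !(diag_mull _ _ _ dM).
have xE (h : 'I_d.+1) : diag_mx (\row_i x i) h h = x h by rewrite !mxE eqxx.
have tE (h : 'I_d.+1) : M h h = t h by rewrite /t inord_val.
rewrite !xE !tE.
have [->|/tN] := eqVneq (N i j) 0; first by ring.
case/or3P => [/eqP->|/eqP ij|/eqP ij]; first by ring.
  by rewrite /x ij big_ord_recr /=; ring.
by rewrite /x ij big_ord_recr /=; ring.
Qed.

Definition cubic_bracket c0 c1 c2 c3 M N :=
  let X := c0%:M + c1 *: M + c2 *: (M * M) + c3 *: (M * (M * M)) in
  X * N - N * X = M * (M * N * M) - M * N * M * M.

Lemma cnj_cubic_bracket P c0 c1 c2 c3 M N : P \is a GRing.unit ->
  cubic_bracket c0 c1 c2 c3 M N ->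
  cubic_bracket c0 c1 c2 c3 (cnj P M) (cnj P N).
Proof.
move=> uP /(congr1 (cnj P)).
by rewrite /cubic_bracket /= !(cnjB, cnjD, cnjZ, cnjM) // cnjC.
Qed.

(** The matrix X solving the bracket equation in the eigenbasis of A commutes
with A; in the eigenbasis of S, the bracket with S multiplies X 0 j by
t*_j - t*_0, so the first row of X inherits the bandwidth 3 of the right
side. *)
Lemma leonard_cubic_bracket A S P : leonard_mx A S P ->
  exists c0 c1 c2 c3, cubic_bracket c0 c1 c2 c3 A S.
Proof.
move=> lA; have [uP iA dS dA iS] := lA.
have bA := tridiagonal_band iA; have bS := diag_band dS.
have [X' dX' brX'] := tridiagonal_bracket dA iS.
have [X XK] : exists X, cnj P X = X' by exists (cnj P^-1 X'); rewrite cnjVK.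
have brX : X * S - S * X = A * (A * S * A) - A * S * A * A.
  by apply: (can_inj (cnjK uP)); rewrite !cnjB !cnjM // XK.
have cX : X * A = A * X.
  apply: (can_inj (cnjK uP)); rewrite !cnjM // XK; apply/matrixP => i j.
  rewrite (diag_mull _ _ _ dA) (diag_mulr _ _ _ dA).
  have [->|ij] := eqVneq i j; first exact: mulrC.
  by rewrite (is_diag_mxP dX' _ _ ij) mul0r mulr0.
have bASA := band_mul (band_mul bA bS) bA.
have X0 (j : 'I_d.+1) : (4 <= j)%N -> X 0 j = 0.
  move=> j4; move/matrixP/(_ 0 j): brX; rewrite !entryE.
  rewrite (diag_mull _ _ _ dS) (diag_mulr _ _ _ dS).
  rewrite (band_mul bA bASA) ?(band_mul bASA bA) ?add0n // subrr.
  rewrite [S 0 0 * _]mulrC -mulrBr => /eqP.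
  rewrite mulf_eq0 subr_eq0 => /orP[/eqP //|/eqP/(leonard_injr lA) j0].
  by move: j4; rewrite j0.
have [p sp Xp] := centralizer_poly iA cX X0.
exists p`_0, p`_1, p`_2, p`_3; rewrite /cubic_bracket /= -brX Xp.
rewrite (horner_mx_wide _ sp) !big_ord_recl big_ord0 /= addr0 expr0 !exprS.
by rewrite !mulr1 scalemx1 !addrA.
Qed.

(** This is the (0, 3) entry of the bracket equation, divided by
A_01 A_12 A_23. *)
Lemma cubic_bracket_edge c0 c1 c2 c3 A S : (3 <= d)%N ->
  irreducible_tridiagonal A -> is_diag_mx S -> cubic_bracket c0 c1 c2 c3 A S ->
  c3 * (S (inord 3) (inord 3) - S 0 0)
    = S (inord 2) (inord 2) - S (inord 1) (inord 1).
Proof.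
move=> d3 iA dS; have bA := tridiagonal_band iA; have bS := diag_band dS.
rewrite /cubic_bracket /=; set X := (X in X * S - _).
have bAS := band_mul bA bS; have bASA := band_mul bAS bA.
pose o1 : 'I_d.+1 := inord 1; pose o2 : 'I_d.+1 := inord 2.
pose o3 : 'I_d.+1 := inord 3; rewrite -/o1 -/o2 -/o3.
have [v1 v2 v3] : [/\ o1 = 1%N :> nat, o2 = 2%N :> nat & o3 = 3%N :> nat].
  by split; rewrite inord_le3.
have nz : A 0 o1 * A o1 o2 * A o2 o3 != 0.
  by have [_ _ uA] := iA; rewrite !mulf_neq0 ?uA ?v1 ?v2 ?v3.
have X03 : X 0 o3 = c3 * (A 0 o1 * A o1 o2 * A o2 o3).
  rewrite /X !entryE.
  rewrite (band_mul_edge (m := o1) bA (band_mul bA bA)) ?v1 ?v3 //.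
  rewrite (band_mul_edge (i := o1) (m := o2) bA bA) ?v1 ?v2 ?v3 //.
  rewrite (band_mul bA bA) ?v3 // (bA 0 o3) ?v3 // mxE -val_eqE /= v3.
  by rewrite mulr0n; ring.
move=> /matrixP/(_ 0 o3); rewrite !entryE.
rewrite (diag_mull _ _ _ dS) (diag_mulr _ _ _ dS) X03.
rewrite (band_mul_edge (m := o1) bA bASA) ?v1 ?v3 //.
rewrite (band_mul_edge (m := o2) bASA bA) ?v2 ?v3 //.
rewrite (band_mul_edge (m := o2) bAS bA) ?v1 ?v2 ?v3 //.
rewrite (band_mul_edge (m := o1) bAS bA) ?v1 ?v2 // !(diag_mulr _ _ _ dS).
move=> E; apply: (mulfI nz); apply/eqP; rewrite -subr_eq0; apply/eqP.
by move/eqP: E; rewrite -subr_eq0 => /eqP <-; ring.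
Qed.

(** The (i, i + 1) entry of the bracket equation reads
t_i t_{i+1} (t_i - t_{i+1}) = q(t_i) - q(t_{i+1}) for the cubic q with
coefficients c0, c1, c2, c3; dividing by c3 (t_i - t_{i+1}) leaves the form. *)
Lemma cubic_bracket_adjacent c0 c1 c2 c3 M N : c3 != 0 ->
  is_diag_mx M -> injective (fun i => M i i) -> irreducible_tridiagonal N ->
  cubic_bracket c0 c1 c2 c3 M N ->
  adjacent_aw M (c3^-1 - 1) (- (c2 / c3)) (- (c1 / c3)).
Proof.
move=> c3_neq0 dM inj [_ _ uN] + i j ij; rewrite /cubic_bracket /=.
have nij : M i i - M j j != 0.
  rewrite subr_eq0; apply/eqP => /inj /(congr1 val) /= E.
  by move/eqP: ij; rewrite E eqn_leq ltnn andbF.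
move=> /matrixP/(_ i j).
rewrite !(mulrDl, mulrDr) -!scalerAl -!scalerAr -!mulrA !entryE.
have cN c : (c%:M * N) i j = (N * c%:M) i j.
  by congr (fun_of_matrix _ i j); apply/esym/comm_mx_scalar.
rewrite cN !(diag_mull _ _ _ dM) !mulrA !(diag_mulr _ _ _ dM).
have := uN _ _ ij.
move: (M i i) (M j j) nij (N i j) => x y nxy s ns E.
apply: (mulfI (mulf_neq0 (mulf_neq0 c3_neq0 nxy) ns)); rewrite mulr0.
by move/eqP: E; rewrite -subr_eq0 => /eqP <-; rewrite /aw_form; field.
Qed.

Lemma aw_scalars A S P : (3 <= d)%N -> leonard_mx A S P ->
  exists b g r, adjacent_aw (cnj P A) b g r /\
    S (inord 3) (inord 3) - S 0 0
      = (b + 1) * (S (inord 2) (inord 2) - S (inord 1) (inord 1)).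
Proof.
move=> d3 lA; have [uP iA dS dA iS] := lA.
have [c0 [c1 [c2 [c3 br]]]] := leonard_cubic_bracket lA.
have E3 := cubic_bracket_edge d3 iA dS br.
have c3_neq0 : c3 != 0.
  apply: contraTneq isT => c30; move/eqP: E3; rewrite c30 mul0r eq_sym subr_eq0.
  by move=> /eqP/(leonard_injr lA)/(congr1 val)/=; rewrite !inord_le3.
exists (c3^-1 - 1), (- (c2 / c3)), (- (c1 / c3)); split.
  apply: cubic_bracket_adjacent c3_neq0 dA (leonard_injl lA) iS _.
  exact: cnj_cubic_bracket uP br.
by rewrite subrK -E3 mulKf.
Qed.

(** With at most two pairs of adjacent indices, gamma = t_0 + t_2 makes the form
take the same value on (t_0, t_1) and (t_1, t_2), and rho cancels it.  For
d < 2 some t k are values at a default index; the choice works whatever they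
are. *)
Lemma adjacent_aw_small M : (d < 3)%N -> exists g r, adjacent_aw M 0 g r.
Proof.
move=> d3; pose t k := M (inord k) (inord k).
exists (t 0 + t 2), (t 0 ^+ 2 + t 1 ^+ 2 - (t 0 + t 2) * (t 0 + t 1)).
move=> i j ij; have tE (h : 'I_d.+1) : M h h = t h by rewrite /t inord_val.
have i2 : (i < 2)%N by rewrite -ltnS -ij (leq_trans (ltn_ord j)).
rewrite !tE ij /aw_form; case: (nat_of_ord i) i2 => [|[|]] // _; ring.
Qed.

Section FourEigenvalues.

Variables (M : 'M[K]_d.+1) (d3 : (3 <= d)%N).
Hypothesis inj : injective (fun i => M i i).

Local Notation t k := (M (inord k) (inord k)).

Lemma adjacent_aw_step b g r k : adjacent_aw M b g r -> (k < 3)%N ->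
  aw_form b g r (t k) (t k.+1) = 0.
Proof. by move=> aM k3; apply: aM; rewrite !inord_le3 // ltnW. Qed.

Lemma four_eigenvalues_neq k l : (k <= 3)%N -> (l <= 3)%N -> k != l ->
  t k != t l.
Proof.
move=> k3 l3; apply: contra_neq => /inj/(congr1 (@nat_of_ord _)).
by rewrite !inord_le3.
Qed.

Lemma adjacent_aw_four_term b g r : adjacent_aw M b g r ->
  t 3 - M 0 0 = (b + 1) * (t 2 - t 1).
Proof.
move=> aM; have -> : 0 = inord 0 :> 'I_d.+1.
  by apply: val_inj; rewrite /= inord_le3.
apply: (four_term (g := g) (r := r));
  by rewrite ?four_eigenvalues_neq ?adjacent_aw_step.
Qed.

Lemma adjacent_aw_unique b g r b' g' r' :
  adjacent_aw M b g r -> adjacent_aw M b' g' r' ->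
  [/\ b = b', g = g' & r = r'].
Proof.
move=> aM aM'.
have ut : uniq [:: t 0; t 1; t 2; t 3].
  by rewrite /= !inE !negb_or !four_eigenvalues_neq.
by apply: aw_form_inj ut _ _ _ _ _ _; apply: adjacent_aw_step.
Qed.

End FourEigenvalues.

(** The two constructions give the same beta because, by the four-term
relation, the one for (A, S) also satisfies the equation that the dual one
yields for the eigenvalues of A. *)
Lemma aw_form_scalars A S P : leonard_mx A S P ->
  exists b g r gs rs, adjacent_aw (cnj P A) b g r /\ adjacent_aw S b gs rs.
Proof.
move=> lA; case: (ltnP d 3) => d3.
  have [g [r aA]] := adjacent_aw_small (cnj P A) d3.
  have [gs [rs aS]] := adjacent_aw_small S d3.
  by exists 0, g, r, gs, rs.
have [b [g [r [aA _]]]] := aw_scalars d3 lA.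
have [b' [gs [rs []]]] := aw_scalars d3 (leonard_dual lA).
have [uP _ _ _ _] := lA; rewrite cnjK // => aS eA.
exists b, g, r, gs, rs; split=> //; suff -> : b = b' by [].
have injA := leonard_injl lA.
apply: (addIr 1); apply: (mulIf (x := cnj P A (inord 2) (inord 2)
   - cnj P A (inord 1) (inord 1))).
  by rewrite subr_eq0 (four_eigenvalues_neq d3 injA).
by rewrite -eA (adjacent_aw_four_term d3 injA aA).
Qed.

(** * The relations *)

(** Both sides are A^2 S^2 - S^2 A^2 - b (A S A S - S A S A)
- g (A S^2 - S^2 A) - gs (A^2 S - S A^2).  The common scalar b and the
crosswise subtraction of the g and gs terms are what makes them agree. *)
Lemma aw_word_commutators A S b g r gs rs :
  let L := aw_word A S b g r - gs *: (A * A) in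
  let Ls := aw_word S A b gs rs - g *: (S * S) in
  L * S - S * L = A * Ls - Ls * A.
Proof.
rewrite /= /aw_word !(mulrDl, mulrDr, mulNr, mulrN, scalerDr).
rewrite -!scalerAl -!scalerAr.
rewrite !mulrA; apply/matrixP => i j; rewrite !entryE; ring.
Qed.

(** Written with [*m], as the size n is not of the form d.+1 when it is the
dimension of an abstract space. *)
Definition aw_relations n (A S : 'M[K]_n) (b g gs r rs om et ets : K) :=
  A *m A *m S - b *: (A *m S *m A) + S *m A *m A - g *: (A *m S + S *m A)
    - r *: S = gs *: (A *m A) + om *: A + et%:M /\
  S *m S *m A - b *: (S *m A *m S) + A *m S *m S - gs *: (S *m A + A *m S)
    - rs *: A = g *: (S *m S) + om *: S + ets%:M.

Lemma aw_relationsE A S b g gs r rs om et ets :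
  aw_relations A S b g gs r rs om et ets <->
  aw_word A S b g r = gs *: (A * A) + om *: A + et%:M /\
  aw_word S A b gs rs = g *: (S * S) + om *: S + ets%:M.
Proof. by []. Qed.

Lemma leonard_aw_relations A S P : leonard_mx A S P ->
  exists b g gs r rs om et ets, aw_relations A S b g gs r rs om et ets.
Proof.
move=> lA; have [uP iA dS dA iS] := lA.
case: (posnP d) => [d0|d_gt0].
  (* All matrices are scalar, so eta and eta* absorb the left sides. *)
  have sc M : M = (M 0 0)%:M.
    apply/matrixP => i j; rewrite !mxE.
    have z (h : 'I_d.+1) : h = 0.
      by apply/val_inj/eqP; rewrite -leqn0 (leq_trans (leq_ord h)) ?d0.
    by rewrite !(z i) !(z j) eqxx.
  exists 0, 0, 0, 0, 0, 0, ((aw_word A S 0 0 0) 0 0), ((aw_word S A 0 0 0) 0 0).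
  by apply/aw_relationsE; rewrite !scale0r !add0r -!sc.
have [b [g [r [gs [rs [aA aS]]]]]] := aw_form_scalars lA.
have [om [et E1]] := aw_word_linear lA aA aS.
have lS := leonard_dual lA.
have [|oms [ets]] := aw_word_linear lS (_ : adjacent_aw _ b gs rs) aA.
  by rewrite cnjK.
move/(congr1 (cnj P^-1)); rewrite cnj_aw_word ?unitrV //.
rewrite cnj_quadratic ?unitrV // !cnjK // => E2.
exists b, g, gs, r, rs, om, et, ets; apply/aw_relationsE; split=> //.
rewrite E2; suff -> : om = oms by [].
have /= := aw_word_commutators A S b g r gs rs.
have e (U V : 'M[K]_d.+1) c1 c2 W :
    U = V + c1 *: W + c2%:M -> U - V = c1 *: W + c2%:M.
  by move=> ->; rewrite addrC !addrA addNr add0r.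
rewrite (e _ _ _ _ _ E1) (e _ _ _ _ _ E2).
rewrite !(mulrDl, mulrDr) -!scalerAl -!scalerAr.
(* The (0, 1) entry of (om - oms) [A, S] = 0. *)
have cS (c : K) M : c%:M * M = M * c%:M by apply/esym/comm_mx_scalar.
rewrite !cS.
pose o1 : 'I_d.+1 := inord 1.
have v1 : o1 = 1%N :> nat by rewrite inordK.
move=> /matrixP /(_ 0 o1).
rewrite !entryE !(diag_mull _ _ _ dS) !(diag_mulr _ _ _ dS).
have [_ _ uA] := iA.
have nA : A 0 o1 != 0 by apply: uA; rewrite v1.
have nS : S o1 o1 - S 0 0 != 0.
  rewrite subr_eq0; apply/eqP => /(leonard_injr lA) /(congr1 val) /=.
  by rewrite v1.
move=> E; apply: (mulIf (mulf_neq0 nA nS)); apply/eqP.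
rewrite -subr_eq0; apply/eqP.
by move/eqP: E; rewrite -subr_eq0 => /eqP <-; ring.
Qed.

(** In the eigenbasis of A the right side is diagonal, so the left side vanishes
at (i, i + 1), where the entry of the other matrix is nonzero. *)
Lemma aw_word_adjacent A S P b g r gs om et : leonard_mx A S P ->
  aw_word A S b g r = gs *: (A * A) + om *: A + et%:M ->
  adjacent_aw (cnj P A) b g r.
Proof.
move=> [uP _ _ dA [_ _ uS]] /(congr1 (cnj P)).
rewrite cnj_aw_word // cnj_quadratic // => E i j ij.
move/matrixP/(_ i j): E; rewrite aw_word_diag // !entryE (diag_mulr _ _ _ dA).
have nij : i != j by rewrite -val_eqE /= ij neq_ltn leqnn.
rewrite (is_diag_mxP dA _ _ nij) [_%:M i j]mxE (negPf nij).
rewrite !(mul0r, mulr0) !addr0.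
by move/eqP; rewrite mulf_eq0 (negPf (uS _ _ ij)) orbF => /eqP.
Qed.

Lemma linear_unique M om et om' et' : (0 < d)%N -> irreducible_tridiagonal M ->
  om *: M + et%:M = om' *: M + et'%:M -> om = om' /\ et = et'.
Proof.
move=> d0 [_ _ uM] E; pose o1 : 'I_d.+1 := inord 1.
have v1 : o1 = 1%N :> nat by rewrite inordK.
have eo : om = om'.
  move/matrixP/(_ 0 o1): E; rewrite !entryE !mxE -val_eqE /= v1 !addr0.
  by apply: mulIf; apply: uM; rewrite v1.
split=> //; move: E; rewrite eo => /addrI /matrixP/(_ 0 0).
by rewrite !scalar_mx_entry.
Qed.

Lemma leonard_aw_unique A S P b g gs r rs om et ets
    b' g' gs' r' rs' om' et' ets' :
  (3 <= d)%N -> leonard_mx A S P ->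
  aw_relations A S b g gs r rs om et ets ->
  aw_relations A S b' g' gs' r' rs' om' et' ets' ->
  [/\ [/\ b = b', g = g', gs = gs' & r = r'],
      rs = rs', om = om', et = et' & ets = ets'].
Proof.
move=> d3 lA /aw_relationsE[E1 E2] /aw_relationsE[F1 F2].
have [uP iA dS dA iS] := lA; have lS := leonard_dual lA.
have [eb eg er] := adjacent_aw_unique d3 (leonard_injl lA)
  (aw_word_adjacent lA E1) (aw_word_adjacent lA F1).
have dualE c h k x y z : aw_word S A c h k = x *: (S * S) + y *: S + z%:M ->
    aw_word (cnj P S) (cnj P A) c h k
    = x *: (cnj P S * cnj P S) + y *: cnj P S + z%:M.
  by move/(congr1 (cnj P)); rewrite cnj_aw_word // cnj_quadratic.
have [_ egs ers] := adjacent_aw_unique d3 (leonard_injl lS)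
  (aw_word_adjacent lS (dualE _ _ _ _ _ _ E2))
  (aw_word_adjacent lS (dualE _ _ _ _ _ _ F2)).
subst b' g' r' gs' rs'; have d0 : (0 < d)%N by apply: leq_trans d3.
move: F1; rewrite E1 -!addrA => /addrI F1.
have [eo ee] := linear_unique d0 iA F1.
move: (dualE _ _ _ _ _ _ E2).
rewrite (dualE _ _ _ _ _ _ F2) -!addrA => /addrI G2.
by have [_ ees] := linear_unique d0 iS G2; rewrite eo ee ees.
Qed.

End Leonard.

Lemma leonard_matrices (K : fieldType) n (A S P : 'M[K]_n) : (0 < n)%N ->
  P \in unitmx -> irreducible_tridiagonal A -> is_diag_mx S ->
  is_diag_mx (P *m A *m invmx P) ->
  irreducible_tridiagonal (P *m S *m invmx P) ->
  (exists b g gs r rs om et ets, aw_relations A S b g gs r rs om et ets) /\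
  ((4 <= n)%N ->
    forall b g gs r rs om et ets b' g' gs' r' rs' om' et' ets',
    aw_relations A S b g gs r rs om et ets ->
    aw_relations A S b' g' gs' r' rs' om' et' ets' ->
    [/\ [/\ b = b', g = g', gs = gs' & r = r'],
        rs = rs', om = om', et = et' & ets = ets']).
Proof.
case: n A S P => // d A S P _ uP iA dS dA iS.
have lA : leonard_mx A S P by [].
split; first exact: leonard_aw_relations lA.
by move=> d3 *; apply: leonard_aw_unique lA _ _.
Qed.

(** * From endomorphisms to matrices *)

Section MatrixInBasis.

Variables (K : fieldType) (V : vectType K).
Variables (b : (\dim {:V}).-tuple V) (bV : basis_of {:V} b).
Local Notation mx := (matrix_in_basis b).

Lemma matrix_in_basisM (f g : 'End(V)) : mx (f \o g)%VF = mx f *m mx g.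
Proof. by rewrite /matrix_in_basis (passmx.mxof_comp _ _ bV) trmx_mul. Qed.

Lemma matrix_in_basis_linear : linear mx.
Proof.
by move=> c f g; rewrite /matrix_in_basis passmx.mxof_linear linearP.
Qed.

HB.instance Definition _ := GRing.isSemilinear.Build K _ _ _ mx
  (GRing.semilinear_linear matrix_in_basis_linear).

Lemma matrix_in_basis1 : mx \1%VF = 1%:M.
Proof. by rewrite /matrix_in_basis passmx.mxof1 ?(basis_free bV) // trmx1. Qed.

Lemma matrix_in_basis_inj : injective mx.
Proof. by move=> f g /trmx_inj; apply: (can_inj (passmx.mxofK bV bV)). Qed.

Lemma Askey_WilsonE (A S : 'End(V)) be g gs r rs om et ets :
  Askey_Wilson A S be g gs r rs om et ets <->
  aw_relations (mx A) (mx S) be g gs r rs om et ets.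
Proof.
have mL (f h : 'End(V)) c1 c2 c3 :
    mx ((f \o f \o h) - c1 *: (f \o h \o f) + (h \o f \o f)
      - c2 *: ((f \o h) + (h \o f)) - c3 *: h)%VF
    = mx f *m mx f *m mx h - c1 *: (mx f *m mx h *m mx f)
      + mx h *m mx f *m mx f - c2 *: (mx f *m mx h + mx h *m mx f) - c3 *: mx h.
  by rewrite !(linearB, linearD, linearZ) /= !matrix_in_basisM.
have mR (f : 'End(V)) c1 c2 c3 :
    mx (c1 *: (f \o f) + c2 *: f + c3 *: \1)%VF
    = c1 *: (mx f *m mx f) + c2 *: mx f + c3%:M.
  by rewrite !(linearD, linearZ) /= !matrix_in_basisM matrix_in_basis1 scalemx1.
rewrite /aw_relations -!mL -!mR; split=> [] [E1 E2]; split.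
- by rewrite E1.
- by rewrite E2.
- exact: matrix_in_basis_inj E1.
- exact: matrix_in_basis_inj E2.
Qed.

End MatrixInBasis.

Lemma change_of_basis (K : fieldType) (V : vectType K)
  (b c : (\dim {:V}).-tuple V) : basis_of {:V} b -> basis_of {:V} c ->
  exists2 P, P \in unitmx & forall f : 'End(V),
    matrix_in_basis c f = P *m matrix_in_basis b f *m invmx P.
Proof.
move=> bV cV; pose P := (passmx.mxof b c \1)^T.
pose Q := (passmx.mxof c b \1)^T.
have PQ : P *m Q = 1%:M.
  rewrite /P /Q -trmx_mul -passmx.mxof_comp // comp_lfun1l.
  rewrite passmx.mxof1 ?trmx1 //.
  exact: basis_free cV.
have [uP _] := mulmx1_unit PQ; exists P => // f.
have -> : invmx P = Q by rewrite -[RHS](mulKmx uP) PQ mulmx1.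
rewrite /P /Q /matrix_in_basis -!trmx_mul -!passmx.mxof_comp //.
by rewrite comp_lfun1l comp_lfun1r.
Qed.

Theorem theorem1p5 (K : fieldType) (V : vectType K) (A As : 'End(V)) :
  (0 < \dim {:V})%N ->
  Leonard_pair A As ->
  (exists beta gamma gammas rho rhos omega eta etas : K,
    Askey_Wilson A As beta gamma gammas rho rhos omega eta etas) /\
  ((4 <= \dim {:V})%N ->
    forall beta gamma gammas rho rhos omega eta etas
           beta' gamma' gammas' rho' rhos' omega' eta' etas' : K,
      Askey_Wilson A As beta gamma gammas rho rhos omega eta etas ->
      Askey_Wilson A As beta' gamma' gammas' rho' rhos' omega' eta' etas' ->
      [/\ [/\ beta = beta', gamma = gamma', gammas = gammas' & rho = rho'],
          rhos = rhos', omega = omega', eta = eta' & etas = etas']).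
Proof.
move=> V_gt0 [[b [bV iA dAs]] [c [cV iAs dA]]].
have [P uP PE] := change_of_basis bV cV; rewrite !PE in iAs dA.
have [exAW uniqAW] := leonard_matrices V_gt0 uP iA dAs dA iAs.
split.
  have [be [g [gs [r [rs [om [et [ets E]]]]]]]] := exAW.
  by exists be, g, gs, r, rs, om, et, ets; apply/(Askey_WilsonE bV).
move=> V4 ? ? ? ? ? ? ? ? ? ? ? ? ? ? ? ?.
move=> /(Askey_WilsonE bV) E /(Askey_WilsonE bV) F.
exact: (uniqAW V4) E F.
Qed.
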